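(* Let $m\ge 2$ and $1\le p\le m-1$. Then ${\cal F}^{TG}_{m,p}(x)={\cal F}^{TG}_{m,m-p}(x)$, where ${\cal F}^{TG}_{m,p}(x)=\sum_{n\ge1}f^{TG}_{m,p}(n)x^n$ and $f^{TG}_{m,p}(n)$ is the number of 2-factors of $TG^{(p)}_m(n)$; equivalently, $f^{TG}_{m,p}(n)=f^{TG}_{m,m-p}(n)$ for all $n\ge 1$.
   Context: Torus grid $TG^{(p)}_m(n)$ ($m\ge 2$, $n\ge1$, $0\le p\le m-1$): row indices are taken mod $m$ in $\{1,\dots,m\}$. It is the multigraph (loops and parallel edges allowed; for $m,n\ge 3$ the usual simple graph) on vertex set $\{1,\dots,m\}\times\{1,\dots,n\}$ in which every edge-end carries a direction: for every $j$ and $1\le i\le m$, a vertical edge joining $(i,j)$ (end ''down'') to $(i+1,j)$ (end ''up''); for every $i$ and $1\le j\le n-1$, a horizontal edge joining $(i,j)$ (end ''right'') to $(i,j+1)$ (end ''left''); and for each $1\le i\le m$, an edge joining $(i+p,n)$ (end ''right'') to $(i,1)$ (end ''left''). (It arises from $C_m\times P_{n+1}$ by identifying the vertex in row $i$ of the first column with the vertex in row $i+p$ of the last column.) A 2-factor is a set of edges such that every vertex carries exactly two edge-ends of chosen edges (a loop contributes two). *)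

(* Defs.v *)
From HB Require Import structures.
From mathcomp Require Import all_boot all_order all_algebra.

Set Implicit Arguments.
Unset Strict Implicit.
Unset Printing Implicit Defensive.

Inductive direction := Up | Down | Leftward | Rightward.

(* Finite multigraphs whose edge-ends carry a direction. An edge has exactly
   two ends; it is a loop when both ends lie at the same vertex. *)
Record dmultigraph := DMultigraph {
  vertex : finType;
  edge : finType;
  ends : edge -> (vertex * direction) * (vertex * direction)
}.

(* The number of edge-ends at v of edges of S: a loop at v counts twice. *)
Definition degree_in (G : dmultigraph) (S : {set edge G}) (v : vertex G) : nat :=
  \sum_(e in S) (((ends e).1.1 == v) + ((ends e).2.1 == v)).

Definition two_factor (G : dmultigraph) (S : {set edge G}) : bool :=
  [forall v : vertex G, degree_in S v == 2].

Definition num_two_factors (G : dmultigraph) : nat :=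
  #|[set S : {set edge G} | two_factor S]|.

Lemma row_add_subproof (m p : nat) (i : 'I_m) : (i + p) %% m < m.
Proof. by rewrite ltn_pmod // (leq_ltn_trans (leq0n i)). Qed.

(* Row i + p, row indices being taken mod m; rows and columns are numbered
   from 0. *)
Definition row_add (m p : nat) (i : 'I_m) : 'I_m :=
  Ordinal (row_add_subproof p i).

Definition TG_vertex (m k : nat) : finType := ('I_m * 'I_k.+1)%type.

(* Vertical edges, horizontal edges inside the grid, and the m edges closing
   up the last column onto the first one. *)
Definition TG_edge (m k : nat) : finType :=
  ('I_m * 'I_k.+1 + 'I_m * 'I_k + 'I_m)%type.

Definition TG_ends (m p k : nat) (e : TG_edge m k) :
    (TG_vertex m k * direction) * (TG_vertex m k * direction) :=
  match e with
  | inl (inl (i, j)) => (((i, j), Down), ((row_add 1 i, j), Up))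
  | inl (inr (i, j)) =>
      (((i, widen_ord (leqnSn k) j), Rightward), ((i, lift ord0 j), Leftward))
  | inr i => (((row_add p i, ord_max), Rightward), ((i, ord0), Leftward))
  end.

(* The torus grid TG_m^(p)(n) with n = k + 1 columns. *)
Definition torus_grid (m p k : nat) : dmultigraph :=
  DMultigraph (@TG_ends m p k).

(* f_{m,p}^{TG}(n) for n >= 1; the value at n = 0 is a convention. *)
Definition f_TG (m p n : nat) : nat :=
  if n is k.+1 then num_two_factors (torus_grid m p k) else 0.

(* Formal power series with integer coefficients, s n being the coefficient
   of x^n. *)
Definition fpseries := nat -> int.

(* The sum over n >= 1 of f_{m,p}^{TG}(n) x^n: no constant term. *)
Definition F_TG (m p : nat) : fpseries :=
  fun n => if 0 < n then Posz (f_TG m p n) else Posz 0.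

(* Main.v *)
(** Reflecting the rows, [i |-> m - 1 - i], maps the torus grid with twist [p]
    isomorphically onto the one with twist [-p = m - p] modulo [m], reversing
    the vertical edges and fixing the column of every other edge; an
    isomorphism preserves the number of 2-factors. *)

Require Import Defs.
From HB Require Import structures.
From mathcomp Require Import all_boot all_order all_algebra.
From mathcomp Require Import zify.
From Stdlib Require Import FunctionalExtensionality.

Section Isomorphism.

Variables (G H : dmultigraph).
Variables (f : vertex G -> vertex H) (g : edge G -> edge H).
Hypotheses (f_bij : bijective f) (g_bij : bijective g).
(** Summing over both ends lets [g] interchange the two ends of an edge, as the reflection does with
    vertical edges, and still counts loops twice. *)
Hypothesis incidence_fg : forall e v,
  ((ends (g e)).1.1 == f v) + ((ends (g e)).2.1 == f v) =
  ((ends e).1.1 == v) + ((ends e).2.1 == v).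

Lemma degree_in_imset (S : {set edge G}) (v : vertex G) :
  degree_in (g @: S) (f v) = degree_in S v.
Proof.
rewrite /degree_in big_imset /=; last by move=> x y _ _; apply: bij_inj.
by apply: eq_bigr => e _; apply: incidence_fg.
Qed.

Lemma two_factor_imset (S : {set edge G}) :
  two_factor (g @: S) = two_factor S.
Proof.
have [f' fK f'K] := f_bij.
apply/forallP/forallP => factorS v; last first.
  by rewrite -(f'K v) degree_in_imset.
by rewrite -degree_in_imset.
Qed.

Lemma num_two_factors_iso : num_two_factors G = num_two_factors H.
Proof.
have [g' gK g'K] := g_bij.
(* Taking images under [g] is injective on edge sets, so it remains to show that the images of the
   2-factors of [G] are exactly those of [H]. *)
rewrite /num_two_factors -(card_imset _ (imset_inj (bij_inj g_bij))).
apply: eq_card => S; rewrite inE; apply/imsetP/idP => [[S0]|factorS].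
  by rewrite inE => factorS0 ->; rewrite two_factor_imset.
have gg'S : g @: (g' @: S) = S.
  by rewrite -imset_comp (eq_imset _ g'K) imset_id.
by exists (g' @: S); rewrite ?inE -?two_factor_imset gg'S.
Qed.

End Isomorphism.

Section RowReflection.

Variables (m p : nat).
Hypothesis p_le_m : p <= m.

(** Modulo [m], both sides are [-1 - i - p]; the cases are whether [i + p] wraps around. *)
Lemma rev_ord_row_add (i : 'I_m) :
  row_add (m - p) (rev_ord i) = rev_ord (row_add p i).
Proof.
apply: val_inj => /=; have im := ltn_ord i.
have [ltm|lem] := ltnP (i + p) m.
  rewrite (modn_small ltm).
  have -> : m - i.+1 + (m - p) = m - (i + p).+1 + m by lia.
  by rewrite modnDr modn_small //; lia.
have -> : (i + p) %% m = i + p - m.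
  by rewrite -{1}(subnK lem) modnDr modn_small //; lia.
by rewrite modn_small; lia.
Qed.

(** Shifting by [m - p] and then by [p] is a full turn. For [p = 1] this locates the second end of a
    reflected vertical edge. *)
Lemma row_add_rev_ord (i : 'I_m) :
  row_add p (rev_ord (row_add p i)) = rev_ord i.
Proof.
rewrite -rev_ord_row_add; apply: val_inj => /=.
by rewrite modnDml -addnA subnK // modnDr modn_small ?(ltn_ord (rev_ord i)).
Qed.

End RowReflection.

Definition reflect_vertex (m k : nat) (v : TG_vertex m k) : TG_vertex m k :=
  (rev_ord v.1, v.2).

(* A vertical edge is indexed by its upper end, so its image is indexed by the
   reflection of its lower end. *)
Definition reflect_edge (m k : nat) (e : TG_edge m k) : TG_edge m k :=
  match e with
  | inl (inl (i, j)) => inl (inl (rev_ord (row_add 1 i), j))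
  | inl (inr (i, j)) => inl (inr (rev_ord i, j))
  | inr i => inr (rev_ord i)
  end.

Lemma reflect_vertexK (m k : nat) : involutive (@reflect_vertex m k).
Proof. by case=> i j; rewrite /reflect_vertex /= rev_ordK. Qed.

Lemma reflect_edgeK (m k : nat) : 0 < m -> involutive (@reflect_edge m k).
Proof.
by move=> m0 [[[i j]|[i j]]|i] /=; rewrite ?row_add_rev_ord ?rev_ordK.
Qed.

Lemma num_two_factors_torus_gridC (m p k : nat) : 0 < m -> p <= m ->
  num_two_factors (torus_grid m p k) = num_two_factors (torus_grid m (m - p) k).
Proof.
move=> m0 lepm.
apply: (@num_two_factors_iso (torus_grid m p k) (torus_grid m (m - p) k)
          (@reflect_vertex m k) (@reflect_edge m k)).
- exact: inv_bij (@reflect_vertexK m k).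
- exact: inv_bij (reflect_edgeK _ _ m0).
have reflectE u v : ((rev_ord u.1, u.2) == reflect_vertex m k v) = (u == v).
  exact: (inj_eq (inv_inj (@reflect_vertexK m k)) u v).
case=> [[[i j]|[i j]]|i] v /=.
(* The reflection exchanges the upper and lower ends, hence [addnC]. *)
- by rewrite row_add_rev_ord // (reflectE (_, _)) (reflectE (i, j)) addnC.
- by rewrite (reflectE (i, _)) (reflectE (i, _)).
(* Only the closing edges see the twist: here [p] turns into [m - p]. *)
- by rewrite rev_ord_row_add // (reflectE (_, _)) (reflectE (i, _)).
Qed.

Theorem theorem9 (m p : nat) (hm : 2 <= m) (hp1 : 1 <= p) (hpm : p <= m - 1) :
  F_TG m p = F_TG m (m - p) /\
  (forall n : nat, 1 <= n -> f_TG m p n = f_TG m (m - p) n).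
Proof.
have f_TGC n : f_TG m p n = f_TG m (m - p) n.
  case: n => [|k]; first by [].
  by rewrite /f_TG num_two_factors_torus_gridC; [|lia|lia].
split=> [|n _]; last exact: f_TGC.
by apply: functional_extensionality => n; rewrite /F_TG f_TGC.
Qed.
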